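(* Assume (QP) has an optimal solution, let $\gamma\in(0,1)$, and let $\tau_p,\tau_d>0$ be problem-dependent error bound constants for (QP) (as defined in the context). Put $C_2=\sqrt{n/\gamma}+n$. Let $C>0$ and fix a vector $\lambda\in\mathbb{R}^n$, $\lambda\ge0$, such that $$0<\|\lambda\|<\min\left(1,\ \frac{C}{8\max(\tau_p,\tau_d)}\right).$$ Let $(x,y,s)\in\mathcal{N}_\lambda(\gamma)$ with $$\mu_\lambda<\min\left(1,\ \left(\frac{C}{2\max(\tau_p,\tau_d)\,C_2}\right)^2\right).$$ Then there exists an optimal solution $(x^*,y^*,s^* )$ of (QP) such that $$\bar{\mathcal{S}}_C(s)\subseteq\mathcal{S}(s^* )\subseteq\mathcal{A}(x^* )\subseteq\bar{\mathcal{A}}_C(x).$$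
   Context: Let $H\in\mathbb{R}^{n\times n}$ be symmetric positive semidefinite, $A\in\mathbb{R}^{m\times n}$ with $m\le n$, $b\in\mathbb{R}^m$, $c\in\mathbb{R}^n$. Vector inequalities are componentwise and $\|\cdot\|$ is the Euclidean norm. The pair (QP) consists of the primal problem $\min_x \frac12x^THx+c^Tx$ subject to $Ax=b$, $x\ge0$, and the dual problem $\max_{(x,y,s)} b^Ty-\frac12x^THx$ subject to $A^Ty+s-Hx=c$, $s\ge0$, $y$ free. A triple $(x^*,y^*,s^* )$ is an optimal solution of (QP) if and only if $Ax^*=b$, $A^Ty^*+s^*-Hx^*=c$, $x^*\ge0$, $s^*\ge0$ and $x_i^*s_i^*=0$ for all $i$. For $\lambda\ge0$, $\mathcal{F}^0_\lambda=\{(x,y,s): Ax=b,\ A^Ty+s-Hx=c,\ x+\lambda>0,\ s+\lambda>0\}$. For a triple $(x,y,s)$, $\mu_\lambda=\frac{(x+\lambda)^T(s+\lambda)}{n}$. For $\gamma\in(0,1)$, $\mathcal{N}_\lambda(\gamma)=\{(x,y,s)\in\mathcal{F}^0_\lambda: \gamma\mu_\lambda\le(x_i+\lambda_i)(s_i+\lambda_i)\le\mu_\lambda/\gamma,\ i=1,\dots,n\}$. Problem-dependent error bound constants: $\tau_p,\tau_d>0$ are constants depending only on $(H,A,b,c)$ such that for every $\gamma\in(0,1)$, every $\lambda\ge0$ and every $(x,y,s)\in\mathcal{N}_\lambda(\gamma)$ there is an optimal solution $(x^*,y^*,s^* )$ of (QP) with $\|x-x^*\|<\tau_p\,\beta$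 and $\|s-s^*\|<\tau_d\,\beta$, where $\beta=(\sqrt{n/\gamma}+n)\sqrt{\mu_\lambda}\max(\sqrt{\mu_\lambda},1)+4\|\lambda\|\max(\|\lambda\|,1)$. (Such constants exist when (QP) has an optimal solution.) Sets (with $i$ ranging over $\{1,\dots,n\}$): $\mathcal{A}(x^* )=\{i:x_i^*=0\}$, $\mathcal{S}(s^* )=\{i:s_i^*>0\}$, $\bar{\mathcal{A}}_C(x)=\{i:x_i<C\}$, $\bar{\mathcal{S}}_C(s)=\{i:s_i\ge C\}$. *)

(* Defs.v *)
From HB Require Import structures.
From mathcomp Require Import all_boot all_order all_algebra.
From mathcomp Require Import reals.

Set Implicit Arguments.
Unset Strict Implicit.
Unset Printing Implicit Defensive.

Import Order.TTheory GRing.Theory Num.Theory.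

Local Open Scope ring_scope.

Section Vectors.
Variables (R : realType) (n : nat).
Implicit Types u v : 'cV[R]_n.

Definition dotv u v : R := \sum_i u i 0 * v i 0.

(* Euclidean norm; the norm MathComp-Analysis puts on 'cV[R]_n is the
   max norm. *)
Definition norm2 u : R := Num.sqrt (dotv u u).

Definition psdmx (H : 'M[R]_n) : Prop :=
  H \is symmetricmx /\ forall v, 0 <= dotv v (H *m v).

End Vectors.

Section QP.
Variables (R : realType) (m n : nat).
Variables (H : 'M[R]_n) (A : 'M[R]_(m, n)) (b : 'cV[R]_m) (c : 'cV[R]_n).
Implicit Types (x s lam : 'cV[R]_n) (y : 'cV[R]_m).

Definition primal_feasible x : Prop := A *m x = b /\ forall i, 0 <= x i 0.

Definition primal_obj x : R := 2^-1 * dotv x (H *m x) + dotv c x.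

Definition primal_optimal x : Prop :=
  primal_feasible x /\
  forall x', primal_feasible x' -> primal_obj x <= primal_obj x'.

(* x is one of the variables of the dual problem and is not required to be
   primal feasible there. *)
Definition dual_feasible x y s : Prop :=
  A^T *m y + s - H *m x = c /\ forall i, 0 <= s i 0.

Definition dual_obj x y : R := dotv b y - 2^-1 * dotv x (H *m x).

Definition dual_optimal x y s : Prop :=
  dual_feasible x y s /\
  forall x' y' s', dual_feasible x' y' s' -> dual_obj x' y' <= dual_obj x y.

(* A solution of the primal-dual pair: the same x solves the primal problem
   and is the x-component of a solution of the dual problem.  For H positive
   semidefinite this amounts to the KKT conditions (primal and dual
   feasibility together with x_i s_i = 0 for all i). *)
Definition qp_optimal x y s : Prop := primal_optimal x /\ dual_optimal x y s.

(* The perturbation lam is a vector, with its own component for each i. *)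
Definition mu lam x s : R := dotv (x + lam) (s + lam) / n%:R.

Definition strictly_feasible lam x y s : Prop :=
  [/\ A *m x = b,
      A^T *m y + s - H *m x = c,
      forall i, 0 < x i 0 + lam i 0
    & forall i, 0 < s i 0 + lam i 0].

Definition nbhd gamma lam x y s : Prop :=
  strictly_feasible lam x y s /\
  forall i, gamma * mu lam x s <= (x i 0 + lam i 0) * (s i 0 + lam i 0)
                               <= mu lam x s / gamma.

Definition err_bound gamma lam x s : R :=
  (Num.sqrt (n%:R / gamma) + n%:R) *
    Num.sqrt (mu lam x s) * Num.max (Num.sqrt (mu lam x s)) 1
  + 4 * norm2 lam * Num.max (norm2 lam) 1.

Definition error_bound_constants (tau_p tau_d : R) : Prop :=
  [/\ 0 < tau_p, 0 < tau_d &
    forall gamma lam x y s,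
      0 < gamma < 1 -> (forall i, 0 <= lam i 0) -> nbhd gamma lam x y s ->
      exists xs ys ss,
        [/\ qp_optimal xs ys ss,
            norm2 (x - xs) < tau_p * err_bound gamma lam x s
          & norm2 (s - ss) < tau_d * err_bound gamma lam x s]].

End QP.

Section IndexSets.
Variables (R : realType) (n : nat).
Implicit Types x s : 'cV[R]_n.

Definition active x : {set 'I_n} := [set i | x i 0 == 0].
Definition dual_support s : {set 'I_n} := [set i | 0 < s i 0].
Definition pred_active (C : R) x : {set 'I_n} := [set i | x i 0 < C].
Definition pred_dual_support (C : R) s : {set 'I_n} := [set i | C <= s i 0].

End IndexSets.

(* Main.v *)
(* A point of the neighbourhood lies within C, in each coordinate of x and s,
   of an optimal solution (xs, ys, ss): the hypotheses on lam and mu make the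
   error bound smaller than C / max(tau_p, tau_d).  This gives the two outer
   inclusions.  The middle one is complementarity: Farkas' lemma at the primal
   optimal xs produces multipliers (y', s') with s' orthogonal to xs, and dual
   optimality of (xs, ys, ss) against (xs, y', s') yields
   <xs, ss> <= <xs, s'> = 0. *)
Require Import Defs.
From HB Require Import structures.
From mathcomp Require Import all_boot all_order all_algebra.
From mathcomp Require Import boolp reals.
From mathcomp Require Import ring lra.

Import Order.TTheory GRing.Theory Num.Theory.

Local Open Scope ring_scope.

Section Farkas.
Variables (R : realFieldType) (n : nat).

(* Bartl's induction: if the first inequality [a w >= 0] cannot be dropped, a
   witness [w0] of this, scaled to [a w0 = -1], gives the projection
   [w |-> w + (a w) w0] onto [a w = 0], along which the other inequalities
   are transported. *)
Lemma farkas p (M : 'M[R]_(p, n)) (g : 'rV[R]_n) :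
  (forall w : 'cV[R]_n, (forall i, 0 <= (M *m w) i 0) -> 0 <= (g *m w) 0 0) ->
  exists2 t : 'rV[R]_p, forall i, 0 <= t 0 i & g = t *m M.
Proof.
elim: p M g => [|p IHp] M g Mg.
  exists 0 => [i|]; first by rewrite mxE.
  rewrite mul0mx; apply/rowP => j; rewrite mxE.
  (* With no inequalities left, [g] is nonnegative on both [e_j] and [- e_j], so every entry
     vanishes. *)
  have gd (w : 'cV[R]_n) : 0 <= (g *m w) 0 0 by apply: Mg => -[].
  have gE (e : R) : (g *m (e *: delta_mx j 0 : 'cV_n)) 0 0 = e * g 0 j.
    by rewrite -scalemxAr -(colE j g) !mxE.
  have := gd ((-1) *: delta_mx j 0); have := gd (1 *: delta_mx j 0).
  by rewrite !gE; lra.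
move: M Mg; rewrite -[p.+1]/(1 + p)%N => M.
rewrite -[M]vsubmxK; move: (usubmx M) (dsubmx M) => a N Mg {M}.
have Mge0 (w : 'cV[R]_n) : 0 <= (a *m w) 0 0 -> (forall i, 0 <= (N *m w) i 0) ->
    0 <= (g *m w) 0 0.
  move=> aw Nw; apply: Mg => i; rewrite mul_col_mx.
  case: (split_ordP i) => k ->.
    by rewrite col_mxEu (ord1 k).
  by rewrite col_mxEd.
have [/(IHp N g)[t t0 gE]|] := EM (forall w : 'cV[R]_n,
    (forall i, 0 <= (N *m w) i 0) -> 0 <= (g *m w) 0 0).
  exists (row_mx 0 t) => [i|].
    by case: (split_ordP i) => k ->; rewrite ?row_mxEl ?row_mxEr ?mxE.
  by rewrite mul_row_col mul0mx add0r.
move/existsNP => [w /not_implyP[Nw /negP]]; rewrite -ltNge => gw.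
have aw : (a *m w) 0 0 < 0.
  by rewrite ltNge; apply/negP => aw; have := Mge0 w aw Nw; rewrite leNgt gw.
pose k := - (a *m w) 0 0; have k0 : 0 < k by rewrite oppr_gt0.
pose w0 := k^-1 *: w.
have aw0 : a *m w0 = (-1)%:M.
  rewrite [LHS]mx11_scalar -scalemxAr mxE -[X in _ * X]opprK mulrN.
  by rewrite -/k mulVf ?gt_eqF.
have Nw0 i : 0 <= (N *m w0) i 0.
  by rewrite -scalemxAr mxE mulr_ge0 // invr_ge0 ltW.
have gw0 : (g *m w0) 0 0 < 0.
  by rewrite -scalemxAr mxE pmulr_rlt0 // invr_gt0.
have [v|t t0 gE] := IHp (N + N *m w0 *m a) (g + g *m w0 *m a).
  have E q (B : 'M[R]_(q, n)) :
      (B + B *m w0 *m a) *m v = B *m (v + w0 *m (a *m v)).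
    by rewrite mulmxDl mulmxDr !mulmxA.
  rewrite !E; apply: Mge0.
  by rewrite mulmxDr mulmxA aw0 mul_scalar_mx scaleN1r subrr mxE.
(* Solving [g + g w0 a = t (N + N w0 a)] for [g] gives this coefficient of [a]. It is nonnegative
   because [N w0 >= 0], [t >= 0] and [g w0 < 0]. *)
exists (row_mx (t *m (N *m w0) - g *m w0) t) => [i|].
  case: (split_ordP i) => l ->; last by rewrite row_mxEr.
  rewrite row_mxEl (ord1 l) mxE addr_ge0 //; last by rewrite mxE oppr_ge0 ltW.
  by rewrite mxE sumr_ge0 // => j _; rewrite mulr_ge0.
rewrite mul_row_col mulmxBl.
rewrite mulmxDr !mulmxA in gE.
by rewrite -[LHS](addrK (g *m w0 *m a)) gE !mulmxA -addrA addrC.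
Qed.

End Farkas.

Section Vectors.
Variable R : realType.

Lemma dotvE n (u v : 'cV[R]_n) : dotv u v = (u^T *m v) 0 0.
Proof. by rewrite mxE; apply: eq_bigr => i _; rewrite mxE. Qed.

Lemma dotvC n (u v : 'cV[R]_n) : dotv u v = dotv v u.
Proof. by apply: eq_bigr => i _; rewrite mulrC. Qed.

Lemma dotvDr n (u v w : 'cV[R]_n) : dotv u (v + w) = dotv u v + dotv u w.
Proof. by rewrite !dotvE mulmxDr mxE. Qed.

Lemma dotvZr n a (u v : 'cV[R]_n) : dotv u (a *: v) = a * dotv u v.
Proof. by rewrite !dotvE -scalemxAr mxE. Qed.

Lemma dotv_mulmx m n (B : 'M[R]_(m, n)) (u : 'cV[R]_m) (v : 'cV[R]_n) :
  dotv u (B *m v) = dotv (B^T *m u) v.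
Proof. by rewrite !dotvE trmx_mul trmxK mulmxA. Qed.

Lemma norm_coord_le_norm2 n (u : 'cV[R]_n) i : `|u i 0| <= norm2 u.
Proof.
rewrite -sqrtr_sqr ler_sqrt; last first.
  by apply: sumr_ge0 => j _; rewrite -expr2 sqr_ge0.
rewrite /dotv (bigD1 i) //= expr2 lerDl.
by apply: sumr_ge0 => j _; rewrite -expr2 sqr_ge0.
Qed.

End Vectors.

Section Optimality.
Variables (R : realType) (m n : nat).
Variables (H : 'M[R]_n) (A : 'M[R]_(m, n)) (b : 'cV[R]_m) (c : 'cV[R]_n).
Hypothesis H_sym : H^T = H.
Implicit Types (x d s : 'cV[R]_n) (y : 'cV[R]_m).

Lemma primal_objD x d e :
  primal_obj H c (x + e *: d) =
    primal_obj H c x + e * dotv (H *m x + c) d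
      + 2^-1 * e ^+ 2 * dotv d (H *m d).
Proof.
have HE : dotv x (H *m d) = dotv d (H *m x) by rewrite dotv_mulmx H_sym dotvC.
rewrite /primal_obj mulmxDr -scalemxAr !dotvDr !dotvZr.
rewrite ![dotv (_ + _) _]dotvC !dotvDr !dotvZr.
by rewrite ![dotv (H *m _) _]dotvC [dotv d c]dotvC HE; field.
Qed.

(** If the slope along [d] were negative, a short enough step along [d] would stay feasible and
    lower the objective. *)
Lemma primal_optimal_gradient x d :
  primal_optimal H A b c x -> A *m d = 0 ->
  (forall i, x i 0 = 0 -> 0 <= d i 0) -> 0 <= dotv (H *m x + c) d.
Proof.
move=> [[Axb x0] xmin] Ad0 d0; rewrite leNgt; apply/negP => gd.
set g := dotv _ _ in gd; pose q := dotv d (H *m d).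
(* The step length is [K^-1]. The summand [S] keeps the positive coordinates of [x] nonnegative
   (terms with [x i 0 = 0] are 0 by the convention on division); the last summand makes the linear
   decrease outweigh the quadratic term. *)
pose S := \sum_i `|d i 0| / x i 0; pose K := 1 + S + `|q| / - g.
have S0 : 0 <= S by apply: sumr_ge0 => i _; rewrite divr_ge0.
have qg0 : 0 <= `|q| / - g by rewrite divr_ge0 // oppr_ge0 ltW.
have K0 : 0 < K by rewrite /K; lra.
have feas : primal_feasible A b (x + K^-1 *: d).
  split=> [|i]; first by rewrite mulmxDr -scalemxAr Ad0 scaler0 addr0.
  rewrite !mxE; have [xi0|xi0] := eqVneq (x i 0) 0.
    by rewrite xi0 add0r mulr_ge0 ?invr_ge0 ?(ltW K0) ?d0.
  have xi : 0 < x i 0 by rewrite lt_def xi0 x0.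
  have dK : `|d i 0| / x i 0 <= K.
    apply: (@le_trans _ _ S); last by rewrite /K; lra.
    rewrite /S (bigD1 i) //= lerDl.
    by apply: sumr_ge0 => j _; rewrite divr_ge0.
  rewrite ler_pdivrMr // in dK.
  have dKi : - d i 0 <= K * x i 0 by rewrite (le_trans (ler_norm _)) ?normrN.
  rewrite -(pmulr_rge0 _ K0) mulrDr mulrA divff ?gt_eqF // mul1r; lra.
have := xmin _ feas; rewrite primal_objD -/g -/q.
(* Multiplied by [K ^+ 2], the change of the objective becomes [K * g + q / 2], which the choice of
   [K] makes negative. *)
rewrite -addrA lerDl -(pmulr_rge0 _ K0) -(pmulr_rge0 _ K0).
rewrite (_ : K * _ = K * g + 2^-1 * q); last by field; rewrite gt_eqF.
have qK : `|q| < K * - g by rewrite -ltr_pdivrMr ?oppr_gt0 // /K; lra.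
have := ler_norm q; have := normr_ge0 q; rewrite mulrN in qK; lra.
Qed.

(* Farkas' lemma applied to the feasible directions at [x]. *)
Lemma primal_optimal_multipliers x :
  primal_optimal H A b c x ->
  exists y s, [/\ A^T *m y + s - H *m x = c, forall i, 0 <= s i 0
    & dotv x s = 0].
Proof.
move=> xopt.
(* [D] keeps the coordinates where [x] vanishes. The rows [A], [- A] and [D] together encode
   [A d = 0] and [d i 0 >= 0] at those coordinates. *)
pose D : 'M[R]_n := diag_mx (\row_i (x i 0 == 0)%:R).
have DE q (v : 'M_(n, q)) i j : (D *m v) i j = (x i 0 == 0)%:R * v i j.
  by rewrite mul_diag_mx !mxE.
have [w Mw|t t0 gE] :=
    @farkas R n _ (col_mx A (col_mx (- A) D)) (H *m x + c)^T.
  rewrite -dotvE; apply: primal_optimal_gradient => // [|i xi0].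
    apply/matrixP => i j; rewrite ord1 [RHS]mxE.
    have := Mw (lshift _ i); have := Mw (rshift _ (lshift _ i)).
    rewrite !mul_col_mx !(col_mxEd, col_mxEu) mulNmx mxE; lra.
  have := Mw (rshift _ (rshift _ i)).
  by rewrite !mul_col_mx !col_mxEd DE xi0 eqxx mul1r.
pose t1 := lsubmx t; pose t2 := lsubmx (rsubmx t); pose t3 := rsubmx (rsubmx t).
have tE : t = row_mx t1 (row_mx t2 t3) by rewrite !hsubmxK.
(* The two nonnegative multipliers of [A] and [- A] combine into a free [y]; the factor [D] confines
   [s] to the zeros of [x]. *)
exists (t1 - t2)^T, (t3 *m D)^T; split.
- rewrite -!trmx_mul -linearD /=; apply/eqP; rewrite subr_eq [c + _]addrC; apply/eqP.
  apply: trmx_inj; rewrite trmxK gE tE !mul_row_col mulmxBl mulmxN.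
  by rewrite !addrA.
- move=> i; rewrite trmx_mul tr_diag_mx DE mulr_ge0 // !mxE; exact: t0.
rewrite /dotv big1 // => i _; rewrite trmx_mul tr_diag_mx DE.
by have [->|_] := eqVneq (x i 0) 0; rewrite ?mul0r // mulr0.
Qed.

Lemma qp_optimal_complementary x y s :
  qp_optimal H A b c x y s -> forall i, x i 0 * s i 0 = 0.
Proof.
move=> [xopt [[ysE s0] ymax]].
have [[Axb x0] _] := xopt.
have [y' [s' [ysE' s0' xs']]] := primal_optimal_multipliers x xopt.
(* As [A x = b], for this fixed [x] a larger dual objective means a smaller [<x, u>]. *)
have gap z u : A^T *m z + u - H *m x = c ->
    dotv b z = dotv x (H *m x + c) - dotv x u.
  move=> <-; rewrite [H *m x + _]addrC subrK dotvDr dotv_mulmx trmxK Axb; lra.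
have xs0 i : 0 <= x i 0 * s i 0 by rewrite mulr_ge0.
have : dotv x s <= 0.
  have := ymax x y' s' (conj ysE' s0').
  rewrite /dual_obj (gap _ _ ysE) (gap _ _ ysE') xs'; lra.
move=> xs i; apply: le_anti; rewrite xs0 andbT (le_trans _ xs) //.
by rewrite /dotv (bigD1 i) //= lerDl sumr_ge0.
Qed.

End Optimality.

Theorem theorem7 (R : realType) (m n : nat)
    (H : 'M[R]_n) (A : 'M[R]_(m, n)) (b : 'cV[R]_m) (c : 'cV[R]_n)
    (gamma tau_p tau_d C : R) (lam x s : 'cV[R]_n) (y : 'cV[R]_m) :
  (m <= n)%N ->
  psdmx H ->
  (exists x0 y0 s0, qp_optimal H A b c x0 y0 s0) ->
  0 < gamma < 1 ->
  error_bound_constants H A b c tau_p tau_d ->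
  let C2 := Num.sqrt (n%:R / gamma) + n%:R in
  0 < C ->
  (forall i, 0 <= lam i 0) ->
  0 < norm2 lam < Num.min 1 (C / (8 * Num.max tau_p tau_d)) ->
  nbhd H A b c gamma lam x y s ->
  mu lam x s < Num.min 1 ((C / (2 * Num.max tau_p tau_d * C2)) ^+ 2) ->
  exists xs ys ss,
    [/\ qp_optimal H A b c xs ys ss,
        pred_dual_support C s \subset dual_support ss,
        dual_support ss \subset active xs
      & active xs \subset pred_active C x].
Proof.
move=> _ [Hsym _] _ gamma01 [tp0 td0 errb] C2 C0 lam0 /andP[_ laml] nb mul.
set t := Num.max tau_p tau_d in laml mul.
have t0 : 0 < t by rewrite lt_max tp0.
have HT : H^T = H.
  by move/is_hermitianmxP: Hsym; rewrite expr0 scale1r map_mx_id.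
(* Both maxima in the error bound equal 1. The [mu] term then contributes at most [C / 2] and the
   [lam] term strictly less than [C / 2]. *)
have beta_lt : t * err_bound gamma lam x s < C.
  rewrite /err_bound -/C2; move: laml mul; rewrite !lt_min.
  set l := norm2 lam; set r := mu lam x s.
  move=> /andP[l1 lC] /andP[r1 rC].
  have C20 : 0 <= C2 by rewrite addr_ge0 ?sqrtr_ge0.
  have sr1 : Num.sqrt r <= 1 by rewrite -[leRHS]sqrtr1 ler_wsqrtr // ltW.
  have srC : Num.sqrt r <= C / (2 * t * C2).
    rewrite -[leRHS]ger0_norm; last first.
      by rewrite divr_ge0 ?mulr_ge0 // ltW.
    by rewrite -sqrtr_sqr ler_wsqrtr // ltW.
  rewrite (max_idPr sr1) (max_idPr (ltW l1)) !mulr1.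
  have C2r : t * (C2 * Num.sqrt r) <= C / 2.
    (* [C2 = 0] occurs only for [n = 0]; otherwise the denominator in [srC] can be cleared. *)
    have [->|C2n0] := eqVneq C2 0; first by rewrite mul0r mulr0 divr_ge0 ?ltW.
    have C2p : 0 < C2 by rewrite lt_def C2n0.
    rewrite ler_pdivlMr in srC; last by rewrite !mulr_gt0.
    lra.
  by rewrite ltr_pdivlMr in lC; [lra | rewrite mulr_gt0].
have [xs [ys [ss [opt xC sC]]]] := errb _ _ _ _ _ gamma01 lam0 nb.
have compl := qp_optimal_complementary _ _ _ _ _ _ _ HT _ _ _ opt.
have [[[_ xs0] _] [[_ ss0] _]] := opt.
(* Positivity of the error bound allows [tau_p] and [tau_d] to be replaced by their maximum [t]. *)
have beta0 : 0 < err_bound gamma lam x s.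
  by rewrite -(pmulr_rgt0 _ tp0) (le_lt_trans (sqrtr_ge0 _) xC).
have coord_lt (u v : 'cV[R]_n) tau i :
    norm2 (u - v) < tau * err_bound gamma lam x s -> tau <= t ->
    `|u i 0 - v i 0| < C.
  move=> uv taut; apply: le_lt_trans beta_lt.
  apply: le_trans (_ : tau * err_bound gamma lam x s <= _); last first.
    by rewrite ler_pM2r.
  have := norm_coord_le_norm2 _ _ (u - v) i; rewrite !mxE => /le_trans -> //.
  exact: ltW.
exists xs, ys, ss; split => //; apply/subsetP => i; rewrite !inE.
- move=> Csi; rewrite lt_def ss0 andbT; apply/eqP => ssi.
  have := coord_lt s ss tau_d i sC; rewrite ssi subr0 le_max lexx orbT.
  by move=> /(_ isT); rewrite ltNge (le_trans Csi (ler_norm _)).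
- by move=> ssi; have /eqP := compl i; rewrite mulf_eq0 (gt_eqF ssi) orbF.
- move=> /eqP xsi; have := coord_lt x xs tau_p i xC.
  rewrite xsi subr0 le_max lexx => /(_ isT).
  exact: le_lt_trans (ler_norm _).
Qed.
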